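(* Let $K$ be a compact line, $L$ be a countable compact Hausdorff space and $\phi:K\to L$ be a continuous surjection. Then, for any $\varepsilon>0$, the subspace $\phi^*C(L)$ has the $c_0$-extension property with constant $2+\varepsilon$ in $C(K)$.
   Context: All Banach spaces are real. A compact line is a linearly ordered set which is compact in the order topology. For a compact Hausdorff space $K$, $C(K)$ denotes the Banach space of real-valued continuous functions on $K$ with the supremum norm. For a continuous map $\phi:K\to L$ between compact Hausdorff spaces, $\phi^*:C(L)\to C(K)$ is the composition map $f\mapsto f\circ\phi$, and $\phi^*C(L)$ denotes its range (when $\phi$ is onto, $\phi^*$ is an isometric embedding, so the range is a closed subspace). Given $\lambda\ge1$, a closed subspace $Y$ of a Banach space $X$ has the $c_0$-extension property with constant $\lambda$ in $X$ if every bounded linear operator $T:Y\to c_0$ admits a bounded linear extension $T':X\to c_0$ with $\Vert T'\Vert\le\lambda\Vert T\Vert$. *)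

(* Defs.v *)
From HB Require Import structures.
From mathcomp Require Import all_boot all_order all_algebra.
From mathcomp Require Import ring lra.
From mathcomp Require Import all_classical all_reals all_analysis.

Set Implicit Arguments.
Unset Strict Implicit.
Unset Printing Implicit Defensive.

Import Order.TTheory GRing.Theory Num.Theory.
Import numFieldNormedType.Exports.

Local Open Scope classical_set_scope.
Local Open Scope ring_scope.

(* Both C(K) and c_0 are Banach spaces of bounded real functions under the
   supremum norm; the next record collects what is needed for a set of functions
   on T to be such a space, so that the norm is constructed only once. *)
Record supSpace (R : realType) (T : Type) := SupSpace {
  sup_set :> set (T -> R) ;
  sup_set0 : sup_set 0 ;
  sup_set_lin : forall (a : R) f g,
    sup_set f -> sup_set g -> sup_set (a *: f + g) ;
  sup_set_bnd : forall f, sup_set f -> exists M, forall x, `|f x| <= M ;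
  sup_set_unif : forall f,
    (forall e, 0 < e -> exists2 g, sup_set g & forall x, `|f x - g x| <= e) ->
    sup_set f }.

Definition sup_pred (R : realType) (T : Type) (S : supSpace R T) :
  {pred T -> R} := mem (sup_set S).

Record supFun (R : realType) (T : Type) (S : supSpace R T) := SupFun {
  sup_fun :> T -> R ;
  sup_funP : sup_fun \in sup_pred S }.

Section supfun.
Variables (R : realType) (T : Type) (S : supSpace R T).

HB.instance Definition _ := [isSub for @sup_fun R T S].
HB.instance Definition _ := [Choice of supFun S by <:].

Fact supset_submod : submod_closed (sup_pred S).
Proof.
split; first by apply/mem_set; exact: sup_set0.
by move=> a f g /set_mem Sf /set_mem Sg; apply/mem_set/sup_set_lin.
Qed.

HB.instance Definition _ :=
  GRing.isSubmodClosed.Build R (T -> R) (sup_pred S) supset_submod.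
HB.instance Definition _ := [SubChoice_isSubLmodule of supFun S by <:].

Implicit Types f g : supFun S.

Definition sup_norm f : R := sup [set `|f x| | x in [set: T]].

Lemma supFunS f : sup_set S f.
Proof. exact: set_mem (sup_funP f). Qed.

Lemma supFun_ext f g : f =1 g -> f = g.
Proof. by move=> fg; apply/val_inj/funext. Qed.

Lemma sup_norm_ub f x : `|f x| <= sup_norm f.
Proof.
apply: ub_le_sup; last by exists x.
have [M fM] := sup_set_bnd (supFunS f).
by exists M => _ [y _ <-].
Qed.

Lemma sup_norm_le f M : 0 <= M -> (forall x, `|f x| <= M) -> sup_norm f <= M.
Proof.
move=> M0 fM; rewrite /sup_norm.
have [->|/set0P A0] := eqVneq [set `|f x| | x in [set: T]] set0.
  by rewrite sup0.
by apply: ge_sup => // _ [x _ <-].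
Qed.

Lemma sup_norm_ge0 f : 0 <= sup_norm f.
Proof.
have [[x _]|T0] := pselect (exists x : T, True).
  by apply: le_trans (sup_norm_ub f x).
suff fT0 : [set `|f x| | x in [set: T]] = set0 by rewrite /sup_norm fT0 sup0.
by apply/seteqP; split=> // r [x]; case: T0; exists x.
Qed.

Fact sup_normD f g : sup_norm (f + g) <= sup_norm f + sup_norm g.
Proof.
apply: sup_norm_le => [|x]; first by rewrite addr_ge0 ?sup_norm_ge0.
by apply: le_trans (ler_normD _ _) _; rewrite lerD ?sup_norm_ub.
Qed.

Fact sup_normZ_le (a : R) f : sup_norm (a *: f) <= `|a| * sup_norm f.
Proof.
apply: sup_norm_le => [|x]; first by rewrite mulr_ge0 ?sup_norm_ge0.
by rewrite [leLHS]normrM ler_wpM2l ?sup_norm_ub.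
Qed.

Fact sup_normZ (a : R) f : sup_norm (a *: f) = `|a| * sup_norm f.
Proof.
apply/eqP; rewrite eq_le sup_normZ_le /=.
have [->|a0] := eqVneq a 0; first by rewrite normr0 mul0r sup_norm_ge0.
rewrite -ler_pdivlMl ?normr_gt0// -normfV.
by apply: le_trans (sup_normZ_le _ _); rewrite scalerA mulVf// scale1r.
Qed.

Fact sup_norm0 f : sup_norm f = 0 -> f = 0.
Proof.
move=> f0; apply: supFun_ext => x; apply/eqP.
by rewrite [X in _ == X](_ : _ = 0)// -normr_le0 -f0 sup_norm_ub.
Qed.

HB.instance Definition _ :=
  Lmodule_isNormed.Build R (supFun S) sup_normD sup_normZ sup_norm0.

Lemma supFun_normE f : `|f| = sup_norm f.
Proof. by []. Qed.

Fact supFun_complete (F : set_system (supFun S)) :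
  ProperFilter F -> cauchy F -> cvg F.
Proof.
move=> FF cF.
have cFx e : 0 < e -> exists g, F (ball g e) by exact: (cauchyP F).1.
pose ev (x : T) (g : supFun S) : R := g x.
have ballP g h e : ball g e h -> forall x, `|g x - h x| <= e.
  rewrite -ball_normE /= => /ltW + x; apply: le_trans.
  exact: (sup_norm_ub (g - h) x).
have cvev x : cvg (ev x @ F).
  apply/cauchy_cvgP/cauchyP => e e0.
  have [g Fg] := cFx _ (divr_gt0 e0 (ltr0n R 2) : 0 < e / 2).
  exists (g x); apply: (@filterS _ F _ _ _ _ Fg) => h /ballP gh.
  rewrite /= -ball_normE /=; apply: le_lt_trans (gh x) _.
  by rewrite ltr_pdivrMr// ltr_pMr// ltr1n.
pose l x := lim (ev x @ F).
have lP e : 0 < e -> exists2 g, F (ball g e) & forall x, `|l x - g x| <= e.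
  move=> e0; have [g Fg] := cFx _ e0; exists g => // x.
  have gl : `|g x - ev x h| @[h --> F] --> `|g x - l x|.
    by apply: cvg_norm; apply: cvgB; [exact: cvg_cst|exact: cvev].
  rewrite distrC; apply: (cvgr_to_le gl).
  by apply: (@filterS _ F _ _ _ _ Fg) => h /ballP.
have Sl : l \in sup_pred S.
  apply/mem_set/sup_set_unif => e /lP[g _ lg].
  by exists g => //; exact: supFunS.
pose L : supFun S := SupFun Sl.
apply/cvg_ex; exists L; apply/cvgrPdist_le => e e0.
have [g Fg lg] := lP _ (divr_gt0 e0 (ltr0n R 2) : 0 < e / 2).
apply: filterS Fg => h /ballP gh.
apply: sup_norm_le => [|x]; first exact: ltW.
rewrite (_ : (L - h : supFun S) x = (l x - g x) + (g x - h x)); last first.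
  by rewrite addrA subrK.
by rewrite (le_trans (ler_normD _ _))// [leRHS]splitr lerD.
Qed.

HB.instance Definition _ := Uniform_isComplete.Build (supFun S) supFun_complete.

End supfun.

Section continuous_functions.
Variables (R : realType) (K : topologicalType).
Hypothesis cK : compact [set: K].

Definition cont_set : set (K -> R) := [set f | continuous f].

Fact cont_set0 : cont_set 0.
Proof. by move=> x; exact: cvg_cst. Qed.

Fact cont_set_lin (a : R) f g :
  cont_set f -> cont_set g -> cont_set (a *: f + g).
Proof. by move=> cf cg x; apply: cvgD; [apply: cvgZ; [exact: cvg_cst|exact: cf]|exact: cg]. Qed.

Fact cont_set_bnd f : cont_set f -> exists M, forall x, `|f x| <= M.
Proof.
move=> cf; have cfK : compact (f @` [set: K]).
  by apply: continuous_compact => //; exact: continuous_subspaceT.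
have /compact_bounded/pinfty_ex_gt0[M _ fM] := cfK; exists M => x; apply: fM.
by exists x.
Qed.

Fact cont_set_unif f :
  (forall e, 0 < e -> exists2 g, cont_set g & forall x, `|f x - g x| <= e) ->
  cont_set f.
Proof.
move=> fg x; apply/cvgrPdist_le => e e0.
have e3 : 0 < e / 3 by rewrite divr_gt0.
have [g cg fge] := fg _ e3.
have /cvgrPdist_le/(_ _ e3) := cg x; apply: filterS => y gxy.
rewrite (_ : f x - f y = (f x - g x) + (g x - g y) + (g y - f y)); last by ring.
rewrite (_ : e = e / 3 + e / 3 + e / 3); last by field.
apply: le_trans (ler_normD _ _) (lerD _ _); last by rewrite distrC.
by apply: le_trans (ler_normD _ _) (lerD _ _).
Qed.

Definition cont_space : supSpace R K :=
  SupSpace cont_set0 cont_set_lin cont_set_bnd cont_set_unif.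

(* Compactness of K is a parameter because the supremum norm needs it. *)
Definition C : Type := supFun cont_space.

End continuous_functions.

Section null_sequences.
Variable R : realType.

Definition null_seq_set : set (nat -> R) := [set u | u @ \oo --> (0 : R)].

Fact null_seq_set0 : null_seq_set 0.
Proof. exact: cvg_cst. Qed.

Fact null_seq_set_lin (a : R) u v :
  null_seq_set u -> null_seq_set v -> null_seq_set (a *: u + v).
Proof.
move=> u0 v0; have : (a *: u + v) @ \oo --> a *: (0 : R) + 0.
  by apply: cvgD => //; apply: cvgZ => //; exact: cvg_cst.
by rewrite scaler0 addr0.
Qed.

Fact null_seq_set_bnd u : null_seq_set u -> exists M, forall n, `|u n| <= M.
Proof.
move=> u0; have cu : cvgn u by apply/cvg_ex; exists 0.
have /pinfty_ex_gt0[M _ uM] := cvg_seq_bounded cu.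
by exists M => n; exact: uM.
Qed.

Fact null_seq_set_unif u :
  (forall e, 0 < e -> exists2 v, null_seq_set v & forall n, `|u n - v n| <= e) ->
  null_seq_set u.
Proof.
move=> uv; apply/cvgrPdist_le => e e0.
have e2 : 0 < e / 2 by rewrite divr_gt0.
have [v v0 uve] := uv _ e2.
have /cvgrPdist_le/(_ _ e2) := v0; apply: filterS => n vn.
rewrite (_ : 0 - u n = (0 - v n) + (v n - u n)); last by ring.
rewrite [leRHS]splitr; apply: le_trans (ler_normD _ _) (lerD _ _) => //.
by rewrite distrC.
Qed.

Definition null_space : supSpace R nat :=
  SupSpace null_seq_set0 null_seq_set_lin null_seq_set_bnd null_seq_set_unif.

Definition c0 : Type := supFun null_space.

End null_sequences.

Record closedSubspace (R : realType) (X : normedModType R) := ClosedSubspace {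
  subspace_set :> set X ;
  subspace_set0 : subspace_set 0 ;
  subspace_set_lin : forall (a : R) u v,
    subspace_set u -> subspace_set v -> subspace_set (a *: u + v) ;
  subspace_set_closed : closed subspace_set }.

Definition subspace_pred (R : realType) (X : normedModType R)
  (Y : closedSubspace X) : {pred X} := mem (subspace_set Y).

Record subspaceOf (R : realType) (X : normedModType R)
    (Y : closedSubspace X) := SubspaceOf {
  subspace_val :> X ;
  subspace_valP : subspace_val \in subspace_pred Y }.

Section subspace_norm.
Variables (R : realType) (X : normedModType R) (Y : closedSubspace X).

HB.instance Definition _ := [isSub for @subspace_val R X Y].
HB.instance Definition _ := [Choice of subspaceOf Y by <:].

Fact subspace_submod : submod_closed (subspace_pred Y).
Proof.
split; first by apply/mem_set; exact: subspace_set0.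
by move=> a u v /set_mem Yu /set_mem Yv; apply/mem_set/subspace_set_lin.
Qed.

HB.instance Definition _ :=
  GRing.isSubmodClosed.Build R X (subspace_pred Y) subspace_submod.
HB.instance Definition _ := [SubChoice_isSubLmodule of subspaceOf Y by <:].

Definition subspace_norm (y : subspaceOf Y) : R := `|subspace_val y|.

Fact subspace_normD (y z : subspaceOf Y) :
  subspace_norm (y + z) <= subspace_norm y + subspace_norm z.
Proof. exact: ler_normD. Qed.

Fact subspace_normZ (a : R) (y : subspaceOf Y) :
  subspace_norm (a *: y) = `|a| * subspace_norm y.
Proof. exact: normrZ. Qed.

Fact subspace_norm0 (y : subspaceOf Y) : subspace_norm y = 0 -> y = 0.
Proof. by move=> /normr0_eq0 y0; exact: val_inj. Qed.

HB.instance Definition _ := Lmodule_isNormed.Build R (subspaceOf Y)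
  subspace_normD subspace_normZ subspace_norm0.

End subspace_norm.

Definition bounded_operator (R : realType) (V W : normedModType R)
  (T : {linear V -> W}) : Prop := bounded_near T (nbhs (0 : V)).

(* Meaningful only for a bounded T: the supremum of an unbounded set is 0. *)
Definition opnorm (R : realType) (V W : normedModType R)
  (T : {linear V -> W}) : R := sup [set `|T x| | x in [set x | `|x| <= 1]].

Definition c0_extension_property (R : realType) (X : completeNormedModType R)
    (Y : closedSubspace X) (lambda : R) : Prop :=
  forall T : {linear subspaceOf Y -> c0 R}, bounded_operator T ->
  exists T' : {linear X -> c0 R},
    [/\ bounded_operator T',
        forall y : subspaceOf Y, T' (subspace_val y) = T y &
        opnorm T' <= lambda * opnorm T].

Section composition_map.
Variables (R : realType) (K L : topologicalType).
Variables (cK : compact [set: K]) (cL : compact [set: L]).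
Variables (phi : K -> L) (cphi : continuous phi).

Fact comp_mapP (f : C R cL) : (f \o phi) \in sup_pred (cont_space R cK).
Proof.
have cf : continuous f := supFunS f.
by apply/mem_set => x; apply: continuous_comp; [exact: cphi|exact: cf].
Qed.

Definition comp_map (f : C R cL) : C R cK := SupFun (comp_mapP f).

Lemma comp_map_lin (a : R) (f g : C R cL) :
  comp_map (a *: f + g) = a *: comp_map f + comp_map g.
Proof. exact: supFun_ext. Qed.

Hypothesis sphi : set_surj [set: K] [set: L] phi.

Lemma comp_map_norm (f : C R cL) : `|comp_map f| = `|f|.
Proof.
apply/eqP; rewrite eq_le; apply/andP; split.
  by apply: sup_norm_le => [|x] //; exact: (sup_norm_ub f (phi x)).
apply: sup_norm_le => // y.
by have [x _ <-] := sphi (I : [set: L] y); exact: (sup_norm_ub (comp_map f) x).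
Qed.

Fact range_set0 : range comp_map 0.
Proof. by exists 0 => //; exact: supFun_ext. Qed.

Fact range_set_lin (a : R) u v :
  range comp_map u -> range comp_map v -> range comp_map (a *: u + v).
Proof.
by move=> [f _ <-] [g _ <-]; exists (a *: f + g) => //; exact: comp_map_lin.
Qed.

Fact range_closed : closed (range comp_map).
Proof.
move=> u /= clu.
have near_u e : 0 < e ->
    exists f : C R cL, forall x, `|u x - f (phi x)| <= e.
  move=> e0; have [_ [[f _ <-] /ltW uf]] := clu _ (nbhsx_ballx u e e0).
  by exists f => x; apply: le_trans uf; exact: (sup_norm_ub (u - comp_map f) x).
have [s sK] : {s : L -> K | forall y, phi (s y) = y}.
  have sE y : {x | phi x = y}.
    by apply/cid; have [x _] := sphi (I : [set: L] y); exists x.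
  by exists (fun y => projT1 (sE y)) => y; exact: projT2 (sE y).
have us : u \o s \in sup_pred (cont_space R cL).
  apply/mem_set/sup_set_unif => e /near_u[f uf].
  by exists f; [exact: supFunS|move=> y; have := uf (s y); rewrite sK].
exists (SupFun us) => //; apply: supFun_ext => x /=; apply/eqP.
rewrite -subr_eq0 -normr_le0; apply/ler_addgt0Pl => e e0; rewrite addr0.
have [f uf] := near_u _ (divr_gt0 e0 (ltr0n R 2) : 0 < e / 2).
rewrite (_ : u (s (phi x)) - u x =
  (u (s (phi x)) - f (phi x)) + (f (phi x) - u x)); last by ring.
rewrite [leRHS]splitr; apply: le_trans (ler_normD _ _) (lerD _ _).
  by have := uf (s (phi x)); rewrite sK.
by rewrite distrC.
Qed.

Definition comp_range : closedSubspace (C R cK) :=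
  ClosedSubspace range_set0 range_set_lin range_closed.

End composition_map.

(* Main.v *)
Require Import Defs.
From HB Require Import structures.
From mathcomp Require Import all_boot all_order all_algebra.
From mathcomp Require Import lra.
From mathcomp Require Import all_classical all_reals all_analysis.

(** Write an operator from [phi^* C(L)] to [c_0] as a bounded sequence of
    functionals [mu n] on [C(L)] that tends pointwise to [0], and let [M] be its
    norm.  Extending it means lifting each [mu n] to a functional [nu n] on
    [C(K)] of norm at most [(2 + e) M], so that the lifts still tend to [0].

    The geometry of [K] and [L] enters only through [collapsing_maps]: there are
    locally constant maps [c k : L -> L] and maps [rho k : K -> K] over them
    ([phi \o rho k = c k \o phi]) such that [f \o rho k] converges uniformly to
    [f] for every continuous [f].  Given these, let [s] be a section of [phi].
    The limit [mu' n h] of [mu n (h \o s \o c j)] in [j], along an ultrafilter, is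
    a lift of [mu n] of norm at most [M] to all bounded functions on [K].  Put
      nu n f = mu' n (f - f \o rho k) + mu n (f \o s \o c k),  with k = k(n).
    For [f = g \o phi], both [mu' n (f \o rho k)] and the last term are
    [mu n (g \o c k)], so they cancel and [nu n] lifts [mu n]. The first term
    has norm at most [2 M] and is at most [M] times the distance from [f] to [f \o rho k],
    which is small when [k] is large. In the second one, [f \o s \o c k] is a
    combination of the indicators of the finitely many fibres of [c k], and
    [mu n] tends to [0] on each of them; if [k(n)] tends to infinity slowly enough,
    this term has norm at most [e M] and tends to [0].
    This is [functionals_extension].

    To build the maps, start from retractions onto the fibres of [phi].  As
    [L] is countable, it is zero-dimensional, so each point outside a fibre [F]
    is separated from [F] by a clopen set.  This lets every gap of [F] in the
    line be cut in two at a jump of [K], and sending the left part of the gap to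
    its left end and the right part to its right end is a continuous retraction
    of [K] onto [F] that is locally constant off [F] ([line_retraction]).  Let
    [r w] be this retraction for the fibre over [w].

    Enumerate [L], and let [W w k] be clopen sets shrinking to [w]. Let [c k y]
    be the first [w] in the enumeration with [y] in [W w k] and in a fixed
    clopen neighborhood [U w] of [w], and let [rho k] be [r w] on the preimage
    under [phi] of the set where [c k] is [w]. Near the fibre over [y], a
    continuous [f] is close to [f \o r y]. If [w] is the value of [c k] at a
    point near [y], then for large [k] either [w] is [y], and [f \o rho k] is
    [f \o r y] there, or [w] comes after [y]. In the second case [f \o r w] is
    close to [f \o r y \o r w], as [r w] has its values in the fibre over [w]
    and [w] is near [y] as well. Moreover [f \o r y \o r w] is [f \o r y] again.
    Both facts hold because [U w] is chosen so small that [r y \o r w = r y]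
    over [U w] for each [y] that precedes [w], and that points of [U w] are no
    closer to [y] than [w] is, in terms of the sets [W y l] ([coherent_nbhds]);
    such a choice is possible as [r y] is locally constant near the fibre over
    [w] and only finitely many [y] precede [w]. *)

Set Implicit Arguments.
Unset Strict Implicit.
Unset Printing Implicit Defensive.

Import Order.TTheory GRing.Theory Num.Theory.
Import numFieldNormedType.Exports.

Local Open Scope classical_set_scope.
Local Open Scope ring_scope.

(** * Retractions of a compact line onto a closed subset *)

(** The sections [{x in A | le x a}] form a filter base of closed sets; a cluster
    point lies in all of them.  The relation is abstract so that the lemma gives
    both minima and maxima. *)
Lemma compact_least (T : topologicalType) (le : rel T) (A : set T) :
  total le -> transitive le -> (forall a, closed [set x | le x a]) ->
  compact [set: T] -> closed A -> A !=set0 ->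
  exists2 m, A m & forall a, A a -> le m a.
Proof.
move=> le_total le_trans le_closed cT Acl [a0 Aa0].
pose ray a := A `&` [set x | le x a].
have le_refl x : le x x by have := le_total x x; rewrite orbb.
pose F := filter_from A ray.
have FF : ProperFilter F.
  apply: filter_from_proper; last first.
    by move=> a Aa; exists a; split=> //; exact: le_refl.
  apply: filter_from_filter; first by exists a0.
  move=> a b Aa Ab; have /orP[ab|ba] := le_total a b.
    by exists a => // x [Ax xa]; split; split => //; exact: le_trans ab.
  by exists b => // x [Ax xb]; split; split => //; exact: le_trans ba.
have [m [_ mF]] := cT F FF filterT.
have raym a : A a -> ray a m.
  move=> Aa; have cra : closed (ray a) by exact: closedI.
  by rewrite ((closure_id _).1 cra) => B mB; apply: mF => //; exists a.
by exists m => [|a /raym[]//]; exact: (raym a0 Aa0).1.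
Qed.

Lemma convex_nbhs (d : Order.disp_t) (K : orderTopologicalType d) (x : K) U :
  nbhs x U -> exists I : set K, [/\ nbhs x I, I `<=` U &
    forall y z t, I y -> I z -> (y <= t <= z)%O -> I t].
Proof.
rewrite {1}itv_nbhsE => -[i [io xi] iU]; exists [set` i]; split=> //.
  by apply: open_nbhs_nbhs; split=> //; exact: itv_open_ends_open.
case: i {io xi iU} => l r y z t /=; rewrite !itv_boundlr.
move=> /andP[ly _] /andP[_ zr] /andP[yt tz]; apply/andP; split.
  by apply: le_trans ly _; rewrite bnd_simp.
by apply: le_trans zr; rewrite bnd_simp.
Qed.

Lemma near_gt (d : Order.disp_t) (K : orderTopologicalType d) (a x : K) :
  (a < x)%O -> \forall z \near x, (a < z)%O.
Proof.
move=> ax; have : nbhs x `]a, +oo[%classic.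
  by apply: open_nbhs_nbhs; split; [exact: rray_open|rewrite set_itvE].
by rewrite set_itvE.
Qed.

Lemma near_lt (d : Order.disp_t) (K : orderTopologicalType d) (b x : K) :
  (x < b)%O -> \forall z \near x, (z < b)%O.
Proof.
move=> xb; have : nbhs x `]-oo, b[%classic.
  by apply: open_nbhs_nbhs; split; [exact: lray_open|rewrite set_itvE].
by rewrite set_itvE.
Qed.

Section compact_line.
Variables (d : Order.disp_t) (K : orderTopologicalType d).
Hypothesis cK : compact [set: K].
Implicit Types (A F : set K) (x y z : K).

Lemma closed_min A : closed A -> A !=set0 ->
  exists2 m, A m & forall a, A a -> (m <= a)%O.
Proof.
apply: (@compact_least K <=%O) => //; first exact: le_trans.
by move=> a; have := @lray_closed _ K a; rewrite set_itvE.
Qed.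

Lemma closed_max A : closed A -> A !=set0 ->
  exists2 m, A m & forall a, A a -> (a <= m)%O.
Proof.
apply: (@compact_least K >=%O) => //.
- by move=> y x z /= yx /le_trans; apply.
by move=> a; have := @rray_closed _ K a; rewrite set_itvE.
Qed.

Section retraction.
Variable F : set K.
Hypotheses (Fcl : closed F) (F0 : F !=set0).
Hypothesis Fsep : forall x, ~ F x -> exists V, [/\ clopen V, F `<=` V & ~ V x].

(** When all of [F] lies above [x], the default is the least point of [F], which
    is also the point given by [above_min], and symmetrically there.  So the two
    points differ exactly in the bounded gaps, and one formula for the
    retraction covers the unbounded ones as well. *)
Lemma below_max x : exists m, [/\ F m,
  forall p, F p -> (p <= x)%O -> (p <= m <= x)%O &
  (forall p, F p -> ~~ (p <= x)%O) -> forall p, F p -> (m <= p)%O].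
Proof.
pose below := F `&` [set p | (p <= x)%O].
have [b0|b0] := pselect (below !=set0).
  have cb : closed below.
    by apply: closedI => //; have := @lray_closed _ K x; rewrite set_itvE.
  have [m [Fm mx] mmax] := closed_max cb b0; exists m; split=> //.
    by move=> p Fp px; rewrite mx mmax.
  by move=> H; have := H m Fm; rewrite mx.
have [m Fm mmin] := closed_min Fcl F0; exists m; split=> // p Fp px.
by case: b0; exists p.
Qed.

Lemma above_min x : exists m, [/\ F m,
  forall p, F p -> (x <= p)%O -> (x <= m <= p)%O &
  (forall p, F p -> ~~ (x <= p)%O) -> forall p, F p -> (p <= m)%O].
Proof.
pose above := F `&` [set p | (x <= p)%O].
have [b0|b0] := pselect (above !=set0).
  have cb : closed above.
    by apply: closedI => //; have := @rray_closed _ K x; rewrite set_itvE.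
  have [m [Fm mx] mmin] := closed_min cb b0; exists m; split=> //.
    by move=> p Fp px; rewrite mx mmin.
  by move=> H; have := H m Fm; rewrite mx.
have [m Fm mmin] := closed_max Fcl F0; exists m; split=> // p Fp px.
by case: b0; exists p.
Qed.

(** The cut is the least point of [[a, b]] outside a clopen neighborhood of [F]:
    the points just below it would lie outside that neighborhood too, so there
    are none and its upper ray is open.  The hypotheses come after the witness
    so that the cut can be chosen as a function of [a] and [b] alone; then it is
    the same for all points of a gap. *)
Lemma gap_cut a b : exists c, F a -> F b ->
  (forall p, F p -> (a < p)%O -> (b <= p)%O) ->
  (exists2 x, ~ F x & (a < x < b)%O) ->
  (a < c < b)%O /\ open [set x | (c <= x)%O].
Proof.
have [[Fa Fb ab [x Fx /andP[ax xb]]]|H] := pselect [/\ F a, F b,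
    forall p, F p -> (a < p)%O -> (b <= p)%O &
    exists2 x, ~ F x & (a < x < b)%O]; last first.
  by exists a => *; exfalso; apply: H.
have [V [Vcl FV Vx]] := Fsep Fx.
pose B := `[a, b] `\` V.
have Bcl : closed B.
  by apply: closedI; [exact: itv_closed|apply: open_closedC; case: Vcl].
have [|c [+ Vc] cmin] := closed_min Bcl.
  by exists x; split=> //=; rewrite in_itv/= !ltW.
rewrite /= in_itv /= => /andP[ac cb]; exists c => _ _ _ _.
have {}ac : (a < c)%O.
  by rewrite lt_neqAle ac andbT; apply: contra_notN Vc => /eqP <-; exact: FV.
have {}cb : (c < b)%O.
  by rewrite lt_neqAle cb andbT; apply: contra_notN Vc => /eqP ->; exact: FV.
rewrite ac cb; split=> //.
rewrite openE => z /=; rewrite le_eqVlt => /orP[/eqP <-|cz]; last first.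
  by apply: filterS (near_gt cz) => y; exact: ltW.
rewrite /interior; have nV : nbhs c (~` V).
  by apply: open_nbhs_nbhs; split=> //; apply: closed_openC; case: Vcl.
apply: filterS2 nV (near_gt ac) => y Vy ay.
have [yb|/ltW by_] := leP y b; last exact: (le_trans (ltW cb)).
by apply: cmin; split=> //=; rewrite in_itv/= yb ltW.
Qed.

(** Both ends of a gap of [F] and its cut are the same for all points of the gap,
    so the map is locally constant off [F].  It is continuous at [p] in [F], on
    each side separately: either points of [F] accumulate at [p] and the map,
    which preserves the position relative to [F], is squeezed; or [p] is the end
    of a gap and the map is constantly [p] up to the cut. *)
Lemma line_retraction : exists r : K -> K, [/\ continuous r,
  forall x, F (r x), forall x, F x -> r x = x &
  forall x, ~ F x -> \forall z \near x, r z = r x].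
Proof.
have [lo loP] := choice below_max; have [hi hiP] := choice above_min.
have Flo x : F (lo x) by case: (loP x).
have Fhi x : F (hi x) by case: (hiP x).
have [cut cutP] := choice (fun ab : K * K => gap_cut ab.1 ab.2).
pose r x := if (x < cut (lo x, hi x))%O then lo x else hi x.
have rF x : F (r x) by rewrite /r; case: ifP.
have rE x : r x = lo x \/ r x = hi x by rewrite /r; case: ifP; [left|right].
have r_between p q x : F p -> F q -> (p <= x <= q)%O -> (p <= r x <= q)%O.
  move=> Fp Fq /andP[px xq].
  have [_ /(_ p Fp px) /andP[plo lox] _] := loP x.
  have [_ /(_ q Fq xq) /andP[xhi hiq] _] := hiP x.
  case: (rE x) => ->; first by rewrite plo (le_trans lox).
  by rewrite hiq (le_trans px).
have r_id x : F x -> r x = x.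
  move=> Fx; apply/esym/le_anti/r_between => //; exact/andP.
have cut_gap x : ~ F x -> lo x <> hi x ->
    let c := cut (lo x, hi x) in
    (lo x < c < hi x)%O /\ open [set z | (c <= z)%O].
  move=> Fx lohi.
  have [_ lo1 lo2] := loP x; have [_ hi1 hi2] := hiP x.
  have lox : (lo x < x)%O.
    rewrite lt_neqAle; apply/andP; split.
      by apply/eqP => E; apply: Fx; rewrite -E.
    have [[p [Fp px]]|H] := pselect (exists p, F p /\ (p <= x)%O).
      by case/andP: (lo1 p Fp px).
    have {}lo2 := lo2 (fun p Fp => introN idP (fun px =>
      H (ex_intro _ p (conj Fp px)))).
    exfalso; apply: lohi; apply/le_anti; rewrite lo2//=.
    suff /(hi1 _ (Flo x)) /andP[] : (x <= lo x)%O by [].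
    rewrite leNgt; apply/negP => /ltW lox; apply: H.
    by exists (lo x).
  have hix : (x < hi x)%O.
    rewrite lt_neqAle; apply/andP; split.
      by apply/eqP => E; apply: Fx; rewrite E.
    have [[p [Fp px]]|H] := pselect (exists p, F p /\ (x <= p)%O).
      by case/andP: (hi1 p Fp px).
    have {}hi2 := hi2 (fun p Fp => introN idP (fun px =>
      H (ex_intro _ p (conj Fp px)))).
    exfalso; apply: lohi; apply/le_anti; rewrite hi2 ?andbT//.
    suff /(lo1 _ (Fhi x)) /andP[] : (hi x <= x)%O by [].
    rewrite leNgt; apply/negP => /ltW hix; apply: H.
    by exists (hi x).
  apply: (cutP (lo x, hi x)) => //=; last by exists x => //; rewrite lox.
  move=> p Fp; have [px|xp _] := leP p x.
    by rewrite ltNge => /negP[]; case/andP: (lo1 p Fp px).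
  by case/andP: (hi1 p Fp (ltW xp)).
have lo_eq x z : (forall p, F p -> (p <= x)%O = (p <= z)%O) -> lo x = lo z.
  wlog suff H : x z / (forall p, F p -> (p <= x)%O = (p <= z)%O) ->
      (lo x <= lo z)%O.
    by move=> E; apply/le_anti; rewrite !H// => p Fp; rewrite E.
  move=> E; have [_ lo1 lo2] := loP x; have [_ lo3 lo4] := loP z.
  have [[p [Fp px]]|H] := pselect (exists p, F p /\ (p <= x)%O).
    have /andP[_ lox] := lo1 p Fp px.
    by have /andP[] := lo3 (lo x) (Flo x) (etrans (esym (E _ (Flo x))) lox).
  by apply: lo2 => // p Fp; apply/negP => px; apply: H; exists p.
have hi_eq x z : (forall p, F p -> (x <= p)%O = (z <= p)%O) -> hi x = hi z.
  wlog suff H : x z / (forall p, F p -> (x <= p)%O = (z <= p)%O) ->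
      (hi x <= hi z)%O.
    by move=> E; apply/le_anti; rewrite !H// => p Fp; rewrite E.
  move=> E; have [_ hi1 hi2] := hiP x; have [_ hi3 hi4] := hiP z.
  have [[p [Fp pz]]|H] := pselect (exists p, F p /\ (z <= p)%O).
    have /andP[zhi _] := hi3 p Fp pz.
    by have /andP[] := hi1 (hi z) (Fhi z) (etrans (E _ (Fhi z)) zhi).
  by apply: hi4 => // p Fp; apply/negP => px; apply: H; exists p.
have F_near x : ~ F x -> nbhs x (~` F).
  by move=> Fx; apply: open_nbhs_nbhs; split=> //; exact: closed_openC.
have r_loc x : ~ F x -> \forall z \near x, r z = r x.
  move=> Fx; have [I [nI IF Icv]] := convex_nbhs (F_near x Fx).
  have Ix : I x by exact: nbhs_singleton.
  have F_itv u v : I u -> I v -> forall p, F p -> (p <= u)%O -> (p <= v)%O.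
    move=> Iu Iv p Fp pu; rewrite leNgt; apply/negP => vp.
    by apply: (IF p) => //; apply: Icv Iv Iu _; rewrite pu ltW.
  have F_itv' u v : I u -> I v -> forall p, F p -> (u <= p)%O -> (v <= p)%O.
    move=> Iu Iv p Fp pu; rewrite leNgt; apply/negP => vp.
    by apply: (IF p) => //; apply: Icv Iu Iv _; rewrite pu ltW.
  have lohi z : I z -> lo z = lo x /\ hi z = hi x.
    move=> Iz; split; [apply: lo_eq|apply: hi_eq] => p Fp.
      by apply/idP/idP; exact: F_itv.
    by apply/idP/idP; exact: F_itv'.
  have [E|E] := pselect (lo x = hi x).
    apply: filterS nI => z /lohi[loz hiz].
    by rewrite /r loz hiz E; do 2 case: ifP.
  have [_ co] := cut_gap x Fx E.
  case: (ltP x (cut (lo x, hi x))) => xc.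
    apply: filterS2 nI (near_lt xc) => z /lohi[loz hiz] zc.
    by rewrite /r loz hiz zc xc.
  have nc : nbhs x [set z | (cut (lo x, hi x) <= z)%O].
    exact: open_nbhs_nbhs.
  apply: filterS2 nI nc => z /lohi[loz hiz]/= zc.
  by rewrite /r loz hiz ltNge zc ltNge xc.
exists r; split=> //; move=> p.
have [Fp|/r_loc rp] := pselect (F p); last first.
  by move=> U /= /nbhs_singleton Urp; apply: filterS rp => z /= ->.
move=> U /=; rewrite (r_id p Fp) => /convex_nbhs[I [nI IU Icv]].
have Ip : I p by exact: nbhs_singleton.
have right_side : \forall z \near p, (p < z)%O -> U (r z).
  (* Either [z] is squeezed below some [q] in [F], or [p] starts a gap. *)
  have [[q [Iq Fq pq]]|H] := pselect (exists q, [/\ I q, F q & (p < q)%O]).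
    apply: filterS (near_lt pq) => z zq pz.
    by apply: IU; apply: Icv Ip Iq _; apply: r_between; rewrite // !ltW.
  have [[z0 [Iz0 pz0]]|H0] := pselect (exists z, I z /\ (p < z)%O); last first.
    by apply: filterS nI => z Iz pz; exfalso; apply: H0; exists z.
  have nF z q : I z -> (p < z)%O -> F q -> (p < q)%O -> (z < q)%O.
    move=> Iz pz Fq pq; rewrite ltNge; apply/negP => qz; apply: H.
    by exists q; split=> //; apply: Icv Ip Iz _; rewrite qz ltW.
  have lohi z : I z -> (p < z)%O -> lo z = p /\ hi z = hi z0.
    move=> Iz pz; split.
      have [_ /(_ p Fp (ltW pz)) /andP[plo loz] _] := loP z.
      apply/le_anti; rewrite plo andbT leNgt; apply/negP => /(nF z _ Iz pz (Flo z)).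
      by rewrite ltNge loz.
    apply: hi_eq => q Fq; have [pq|qp] := ltP p q.
      by rewrite !ltW// nF.
    by rewrite !leNgt (le_lt_trans qp pz) (le_lt_trans qp pz0).
  have [lo0 _] := lohi z0 Iz0 pz0.
  have [E|E] := pselect (lo z0 = hi z0).
    apply: filterS nI => z Iz pz; have [loz hiz] := lohi z Iz pz.
    by apply: IU; rewrite /r loz hiz -E lo0; case: ifP.
  have [|/andP[pc _] _] := cut_gap z0 _ E.
    by move=> Fz0; apply: H; exists z0.
  rewrite -[X in (X < _)%O]/(lo z0) lo0 in pc.
  apply: filterS2 nI (near_lt pc) => z Iz zc pz.
  have [loz hiz] := lohi z Iz pz.
  by apply: IU; rewrite /r loz hiz zc.
have left_side : \forall z \near p, (z < p)%O -> U (r z).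
  have [[q [Iq Fq pq]]|H] := pselect (exists q, [/\ I q, F q & (q < p)%O]).
    apply: filterS (near_gt pq) => z zq pz.
    by apply: IU; apply: Icv Iq Ip _; apply: r_between; rewrite // !ltW.
  have [[z0 [Iz0 pz0]]|H0] := pselect (exists z, I z /\ (z < p)%O); last first.
    by apply: filterS nI => z Iz pz; exfalso; apply: H0; exists z.
  have nF z q : I z -> (z < p)%O -> F q -> (q < p)%O -> (q < z)%O.
    move=> Iz pz Fq pq; rewrite ltNge; apply/negP => qz; apply: H.
    by exists q; split=> //; apply: Icv Iz Ip _; rewrite qz ltW.
  have lohi z : I z -> (z < p)%O -> hi z = p /\ lo z = lo z0.
    move=> Iz pz; split.
      have [_ /(_ p Fp (ltW pz)) /andP[zhi hip] _] := hiP z.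
      apply/le_anti; rewrite hip /= leNgt; apply/negP => /(nF z _ Iz pz (Fhi z)).
      by rewrite ltNge zhi.
    apply: lo_eq => q Fq; have [pq|qp] := ltP q p.
      by rewrite !ltW// nF.
    by rewrite !leNgt (lt_le_trans pz qp) (lt_le_trans pz0 qp).
  have [hi0 _] := lohi z0 Iz0 pz0.
  have [E|E] := pselect (lo z0 = hi z0).
    apply: filterS nI => z Iz pz; have [hiz loz] := lohi z Iz pz.
    by apply: IU; rewrite /r loz hiz E hi0; case: ifP.
  have [|/andP[_ cp] _] := cut_gap z0 _ E.
    by move=> Fz0; apply: H; exists z0.
  rewrite -[X in (_ < X)%O]/(hi z0) hi0 in cp.
  apply: filterS2 nI (near_gt cp) => z Iz zc pz.
  have [hiz loz] := lohi z Iz pz.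
  by apply: IU; rewrite /r loz hiz ltNge (ltW zc).
apply: filterS2 left_side right_side => z zl zr /=.
have [zp|pz|->] := ltgtP z p; [exact: zl|exact: zr|].
by apply: IU; rewrite r_id.
Qed.
End retraction.
End compact_line.

(** * Clopen neighborhoods in countable compact spaces *)

(** A Urysohn function separating two points misses a value [t] between [0] and
    [1], because its range is countable; the set where it is below [t] is then
    clopen. *)
Lemma countable_zero_dimensional (R : realType) (L : topologicalType) :
  compact [set: L] -> hausdorff_space L -> countable [set: L] ->
  zero_dimensional L.
Proof.
move=> cL hL countL x y xy.
have cl1 (z : L) : closed [set z].
  by apply: accessible_closed_set1; exact: hausdorff_accessible.
have xy0 : [set x] `&` [set y] = set0.
  by apply/seteqP; split=> // _ [-> /eqP]; rewrite (negPf xy).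
have /(uniform_separatorP (R := R))[f [cf _ f0 f1]] :=
  normal_uniform_separator (compact_normal hL cL) (cl1 x) (cl1 y) xy0.
have fx : f x = 0 by apply: f0; exists x.
have fy : f y = 1 by apply: f1; exists y.
have [t [t0 t1] ft] : exists2 t, 0 < t /\ t < 1 & forall z, f z <> t.
  apply: contrapT => H.
  have sub : (`]0, 1[%classic : set R) `<=` range f.
    move=> t; rewrite /= in_itv /= => /andP[t0 t1]; apply: contrapT => ft.
    by apply: H; exists t => // z fz; apply: ft; exists z.
  have c01 : countable (`]0, 1[%classic : set R).
    apply: (sub_countable (B := [set: L])) countL.
    exact: card_le_trans (subset_card_le sub) (card_image_le _ _).
  have := @countable_lebesgue_measure0 R _ c01.
  rewrite lebesgue_measure_itv /= lte_fin ltr01 -EFinB subr0 => /eqP.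
  by rewrite eqe oner_eq0.
exists (f @^-1` [set r | r < t]); split; last by rewrite /= fy ltNge (ltW t1).
  split; first by apply: open_comp => //; exact: open_lt.
  rewrite (_ : _ @^-1` _ = f @^-1` [set r | r <= t]).
    by apply: closed_comp => //; exact: closed_le.
  apply/seteqP; split=> z /=; first exact: ltW.
  by rewrite le_eqVlt => /orP[/eqP /ft|].
by rewrite /= fx.
Qed.

Lemma clopen_nbhs (L : topologicalType) (U : set L) x : clopen U -> U x -> nbhs x U.
Proof. by move=> [oU _] Ux; exact: open_nbhs_nbhs. Qed.

Lemma clopenC_nbhs (L : topologicalType) (U : set L) x :
  clopen U -> ~ U x -> nbhs x (~` U).
Proof. by move=> /(clopenC U) + Ux; move/clopen_nbhs; apply. Qed.

Section clopen_bases.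
Variables (L : topologicalType) (code : L -> nat).
Hypotheses (cL : compact [set: L]) (zL : zero_dimensional L).
Hypothesis code_inj : injective code.

(** [W w l] excludes the points other than [w] of code less than [l]; by
    compactness such sets shrink to [w]. *)
Lemma clopen_base : exists W : L -> nat -> set L, [/\
  forall w l, clopen (W w l), forall w l, W w l w,
  forall w k l, (k <= l)%N -> W w l `<=` W w k &
  forall w U, nbhs w U -> exists l, W w l `<=` U].
Proof.
have DP (wm : L * nat) : exists D, [/\ clopen D, D wm.1 &
    forall v, code v = wm.2 -> v <> wm.1 -> ~ D v].
  case: wm => w m /=.
  have [[v [<- vw]]|H] := pselect (exists v, code v = m /\ v <> w).
    have /zL[D [Dcl Dw Dv]] : w != v by apply/eqP => /esym.
    by exists D; split=> // u /code_inj ->.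
  exists setT; split=> //; first exact: clopenT.
  by move=> v vm vw; exfalso; apply: H; exists v.
have [D DE] := choice DP.
pose W w l := \big[setI/setT]_(m < l) D (w, val m).
have Wcl w l : clopen (W w l).
  apply: (big_ind clopen) => [|A B|m _]; first exact: clopenT.
    exact: clopenI.
  by case: (DE (w, val m)).
have Ww w l : W w l w.
  apply: (big_ind (fun A : set L => A w)) => // m _.
  by case: (DE (w, val m)).
have Wdec w k l : (k <= l)%N -> W w l `<=` W w k.
  move=> /subnK <-; elim: (l - k)%N => // n IH.
  by rewrite addSn /W big_ord_recr /= => x [/IH].
exists W; split=> // w U.
wlog oU : U / open U.
  move=> H; rewrite nbhsE => -[V [oV Vw] VU].
  by have [//||l WV] := H V; [exact: open_nbhs_nbhs|exists l => x /WV/VU].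
move=> /nbhs_singleton Uw.
have cU : compact (~` U).
  by apply: (subclosed_compact _ cL) => //; exact: open_closedC.
have [|n _ nP] := (compact_near_coveringP _).1 cU _ \oo
    (fun l y => ~ W w l y) _.
  move=> y Uy.
  have Wy : ~ W w (code y).+1 y.
    rewrite /W big_ord_recr /= => -[_].
    have [_ _ /=] := DE (w, code y); apply=> // yw.
    by apply: Uy; rewrite yw.
  exists (~` W w (code y).+1, [set l | (code y < l)%N]); first split.
  - exact: clopenC_nbhs.
  - exact: nbhs_infty_gt.
  - by case=> z l /= [Wz yl] /(Wdec _ _ _ yl).
exists n => x Wx; apply: contrapT => Ux.
by apply: (nP n) Ux Wx => /=.
Qed.

Lemma finite_code (g : L -> L) : (forall y, \forall z \near y, g z = g y) ->
  exists n, forall y, (code (g y) < n)%N.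
Proof.
move=> gloc; have [|n _ nP] := (compact_near_coveringP _).1 cL _ \oo
    (fun n y => (code (g y) < n)%N) _.
  move=> y _; exists ([set z | g z = g y], [set n | (code (g y) < n)%N]).
    by split; [have := gloc y|exact: nbhs_infty_gt].
  by case=> z n /= [->].
by exists n => y; apply: (nP n) => /=.
Qed.

End clopen_bases.

(** * Collapsing a compact line along a map to a countable space *)

Section approximation.
Variables (d : Order.disp_t) (K : orderTopologicalType d).
Hypothesis cK : compact [set: K].
Variable L : topologicalType.
Hypotheses (cL : compact [set: L]) (zL : zero_dimensional L).
Variable code : L -> nat.
Hypothesis code_inj : injective code.
Variable phi : K -> L.
Hypotheses (cphi : continuous phi) (sphi : forall y, exists x, phi x = y).

(** The tube lemma: [phi] is a closed map. *)
Lemma fiber_tube w (G : set K) :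
  (forall x, phi x = w -> nbhs x G) -> \forall y \near w, forall x, phi x = y -> G x.
Proof.
move=> nG.
suff : \forall y \near w, [set: K] `<=` (fun x => phi x = y -> G x).
  by apply: filterS => y Gy x; exact: Gy.
apply: ((compact_near_coveringP _).1 cK L (nbhs w) (fun y x => phi x = y -> G x)).
move=> x _; have [xw|/eqP/zL[U [Ucl Ux Uw]]] := pselect (phi x = w).
  exists (G, setT); first by split; [exact: nG|exact: filterT].
  by case=> z y [].
exists (phi @^-1` U, ~` U); first split.
- by apply: cphi; exact: clopen_nbhs.
- exact: clopenC_nbhs.
- by case=> z y /= [Uz Uy] zy; rewrite -zy in Uy.
Qed.

Lemma fiber_retractions : exists r : L -> K -> K, [/\
  forall w, continuous (r w), forall w x, phi (r w x) = w,
  forall x, r (phi x) x = x &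
  forall w x, phi x <> w -> \forall z \near x, r w z = r w x].
Proof.
have H w : exists r : K -> K, [/\ continuous r,
  forall x, phi (r x) = w, forall x, phi x = w -> r x = x &
  forall x, phi x <> w -> \forall z \near x, r z = r x].
  have cl : closed (phi @^-1` [set w]).
    rewrite -openC openE => x /= /eqP /zL [U [Ucl Ux Uw]].
    rewrite /interior.
    have : nbhs x (phi @^-1` U) by apply: cphi; exact: clopen_nbhs.
    by apply: filterS => z /= Uz zw; rewrite zw in Uz.
  have ne : phi @^-1` [set w] !=set0 by have [x] := sphi w; exists x.
  apply: (line_retraction cK cl ne) => x /= /eqP /zL [U [Ucl Ux Uw]].
  exists (phi @^-1` ~` U); split.
  - by apply: preimage_clopen => //; exact: clopenC.
  - by move=> z /= ->.
  - by apply.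
have [r rP] := choice H; exists r; split=> [w|w|x|w]; last by case: (rP w).
- by case: (rP w).
- by case: (rP w).
- by case: (rP (phi x)) => _ _ ->.
Qed.

Section coherence.
Variables (W : L -> nat -> set L) (r : L -> K -> K).
Hypothesis Wcl : forall w l, clopen (W w l).
Hypothesis Ww : forall w l, W w l w.
Hypothesis Wdec : forall w k l, (k <= l)%N -> W w l `<=` W w k.
Hypothesis Wbase : forall w U, nbhs w U -> exists l, W w l `<=` U.
Hypothesis rcont : forall w, continuous (r w).
Hypothesis r_id : forall x, r (phi x) x = x.
Hypothesis r_loc : forall w x, phi x <> w -> \forall z \near x, r w z = r w x.

(** Over the fibre of [w] both [r v \o r w] and [r v] are locally constant, as
    the fibre is disjoint from that of [v], and they agree there; so they agree
    over a neighborhood of [w].  For the last clause, let [W v l0] miss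
    [w]: it is enough that [U w] avoid those [W v l] with [l <= l0] that miss [w],
    as the later ones lie in [W v l0]. *)
Lemma coherent_nbhds : exists U : L -> set L, [/\
  forall w, clopen (U w), forall w, U w w,
  forall w v x, (code v < code w)%N -> U w (phi x) -> r v (r w x) = r v x &
  forall w v y l, (code v < code w)%N -> U w y -> W v l y -> W v l w].
Proof.
have exE w (m : nat) : exists E, [/\ clopen E, E w &
    forall v, code v = m -> v <> w ->
      (forall x, E (phi x) -> r v (r w x) = r v x) /\
      (forall y l, E y -> W v l y -> W v l w)].
  have [[v [<- vw]]|H] := pselect (exists v, code v = m /\ v <> w); last first.
    exists setT; split=> //; first exact: clopenT.
    by move=> v vm vw; exfalso; apply: H; exists v.
  have nE1 : \forall y \near w, forall x, phi x = y -> r v (r w x) = r v x.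
    apply: fiber_tube => x xw; have xv : phi x <> v by rewrite xw => /esym.
    have rwx : r w x = x by rewrite -xw r_id.
    have H2 : nbhs x (fun u => r v u = r v x) by exact: r_loc.
    have H1 : nbhs x (fun u => r v (r w u) = r v x).
      by apply: (@rcont w x (fun u => r v u = r v x)); rewrite /= rwx.
    by apply: filterS2 H1 H2 => z /= -> ->.
  (* For [l > l0] the set [W v l] lies in [W v l0], which is also avoided. *)
  have nE2 : \forall y \near w, forall l, W v l y -> W v l w.
    have [l0 Wl0] : exists l0, ~ W v l0 w.
      have /zL[U [Ucl Uv Uw]] : v != w by apply/eqP.
      have [l WU] := @Wbase v U (clopen_nbhs Ucl Uv).
      by exists l => /WU.
    have : \forall y \near w, forall l : 'I_l0.+1, W v l y -> W v l w.
      apply: filter_forall => l; have [Wl|Wl] := pselect (W v l w).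
        by apply: filterE.
      have : nbhs w (~` W v l) by exact: clopenC_nbhs.
      by apply: filterS.
    apply: filterS => y H l Wly; have [ll0|ll0] := leqP l l0.
      exact: (H (Ordinal (ll0 : (l < l0.+1)%N))).
    exfalso; apply: Wl0; apply: (H (Ordinal (leqnn l0.+1))) => /=.
    exact: Wdec (ltnW ll0) _ Wly.
  have [l WE] := @Wbase w _ (filterI nE1 nE2).
  exists (W w l); split=> // u /code_inj -> _; split.
    by move=> x /WE[H _]; exact: H.
  by move=> y l' /WE[_ H]; exact: H.
have [E EP] := choice (fun wm : L * nat => exE wm.1 wm.2).
pose U w := \big[setI/setT]_(m < code w) E (w, val m).
have Ucl w : clopen (U w).
  apply: (big_ind clopen) => [|A B|m _]; first exact: clopenT.
    exact: clopenI.
  by case: (EP (w, val m)).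
have Uw w : U w w.
  apply: (big_ind (fun A : set L => A w)) => // m _.
  by case: (EP (w, val m)).
have UE w v : (code v < code w)%N -> U w `<=` E (w, code v).
  by move=> vw; rewrite /U (bigD1 (Ordinal vw)) //=; exact: subIsetl.
exists U; split=> // w v.
  move=> x vw; have vNw : v <> w by move=> vw'; rewrite vw' ltnn in vw.
  have [_ _ /(_ v erefl vNw) [/= H _]] := EP (w, code v).
  by move/(UE _ _ vw)/H.
move=> y l vw; have vNw : v <> w by move=> vw'; rewrite vw' ltnn in vw.
have [_ _ /(_ v erefl vNw) [/= _ H]] := EP (w, code v).
by move/(UE _ _ vw)/H; apply.
Qed.

End coherence.

(** Uniform convergence is checked near one point [y] of [L] at a time, which is
    enough by compactness.  If the value [w] of [c k] at a point near [y] comes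
    after [y], then [f], [f \o r y = f \o r y \o r w] and [f \o r w] are close in
    turn, the last two because [w] lies in the neighborhood of [y] where [f] is
    close to [f \o r y]. *)
Lemma collapsing_maps (R : realType) : exists (c : nat -> L -> L) (rho : nat -> K -> K),
  [/\ forall k y, \forall z \near y, c k z = c k y,
      forall k x, phi (rho k x) = c k (phi x) &
      forall f : K -> R, continuous f -> forall e, 0 < e ->
        \forall k \near \oo, forall x, `|f x - f (rho k x)| <= e].
Proof.
have [W [Wcl Ww Wdec Wbase]] := clopen_base cL zL code_inj.
have [r [rcont phir r_id r_loc]] := fiber_retractions.
have [U [Ucl Uw Ucomp UW]] := coherent_nbhds Wcl Ww Wdec Wbase rcont r_id r_loc.
pose cell k w := W w k `&` U w.
have cell_cl k w : clopen (cell k w) by exact: clopenI.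
have exc (ky : nat * L) : exists w, cell ky.1 w ky.2 /\
    forall v, (code v < code w)%N -> ~ cell ky.1 v ky.2.
  case: ky => k y /=.
  pose p n := `[< exists2 w, code w = n & cell k w y >].
  have exp : exists n, p n by exists (code y); apply/asboolP; exists y.
  case: (ex_minnP exp) => n /asboolP[w wn cw] nmin; exists w; split=> // v vw cv.
  have : p (code v) by apply/asboolP; exists v.
  by move=> /nmin; rewrite -wn leqNgt vw.
have [c' c'P] := choice exc; pose c k y := c' (k, y).
have cP k y : cell k (c k y) y /\
    forall v, (code v < code (c k y))%N -> ~ cell k v y.
  exact: c'P (k, y).
exists c, (fun k x => r (c k (phi x)) x); split=> // [k y|f cf e e0].
  have [cy cmin] := cP k y.
  have n1 : nbhs y (cell k (c k y)) by exact: clopen_nbhs.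
  have n2 : \forall z \near y, forall m : 'I_(code (c k y)),
      forall v, code v = m -> ~ cell k v z.
    apply: filter_forall => m.
    have [[v vm]|H] := pselect (exists v, code v = m); last first.
      by apply: filterE => z v vm; exfalso; apply: H; exists v.
    have : nbhs y (~` cell k v).
      apply: clopenC_nbhs => //; apply: cmin; rewrite vm; exact: ltn_ord.
    by apply: filterS => z cz u; rewrite -vm => /code_inj ->.
  apply: filterS2 n1 n2 => z z1 z2; apply: code_inj; have [cz czmin] := cP k z.
  have [H|H|//] := ltngtP (code (c k z)) (code (c k y)).
    by case: (z2 (Ordinal H) (c k z)).
  by case: (czmin _ H).
have e2 : 0 < e / 2 by rewrite divr_gt0.
suff : \forall k \near \oo,
    [set: L] `<=` (fun y => forall x, phi x = y -> `|f x - f (r (c k y) x)| <= e).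
  by apply: filterS => k Hk x; exact: (Hk (phi x)).
apply: ((compact_near_coveringP _).1 cL nat \oo
    (fun k y => forall x, phi x = y -> `|f x - f (r (c k y) x)| <= e)).
move=> y _.
have : \forall z \near y, forall x, phi x = z -> `|f x - f (r y x)| <= e / 2.
  apply: fiber_tube => x xy.
  have /cvgrPdist_le : (fun z => f z - f (r y z)) @ x --> f x - f (r y x).
    by apply: cvgB; [exact: cf|apply: continuous_comp; [exact: rcont|exact: cf]].
  move=> /(_ _ e2); apply: filterS => z.
  have -> : f x - f (r y x) = 0 by rewrite -xy r_id subrr.
  by rewrite sub0r normrN.
move=> /Wbase[l Wl].
(* Values of [c k] that precede [y] are avoided for large [k]. *)
have n2 : filter_prod (nbhs y) \oo (fun zk : L * nat =>
    forall (m : 'I_(code y)) v, code v = m -> ~ cell zk.2 v zk.1).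
  apply: (filter_forall (F := filter_prod (nbhs y) \oo)) => m.
  have [[v vm]|H] := pselect (exists v, code v = m); last first.
    by apply: filterE => z v vm; exfalso; apply: H; exists v.
  have /zL[V [Vcl Vv Vy]] : v != y.
    by apply/eqP => vy; have := ltn_ord m; rewrite -vm vy ltnn.
  have [k0 WV] := Wbase v V (clopen_nbhs Vcl Vv).
  exists (~` V, [set k | (k0 <= k)%N]); first split.
  - exact: clopenC_nbhs.
  - exact: nbhs_infty_ge.
  - case=> z k /= [Vz k0k] u; rewrite -vm => /code_inj -> [/(Wdec _ _ _ k0k)/WV Vz' _].
    exact: Vz.
have n1 : filter_prod (nbhs y) \oo (fun zk : L * nat =>
    W y l zk.1).
  exists (W y l, setT) => [|[z k] []//].
  by split; [exact: (clopen_nbhs (Wcl y l) (Ww y l))|exact: filterT].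
apply: (filterS2 _ _ n1 n2) => -[z k] /= Wz z2 x xz.
have [[Wc Uc] _] := cP k z.
have ee : e / 2 <= e by lra.
have [cy|yc|/code_inj cy] := ltngtP (code (c k z)) (code y).
- by case: (z2 (Ordinal cy) (c k z) erefl).
- have f1 := Wl _ Wz x xz.
  have f2 := Wl _ (UW _ _ _ _ yc Uc Wz) (r (c k z) x) (phir _ _).
  rewrite Ucomp ?xz// in f2.
  rewrite -(subrKA (f (r y x))) [leRHS]splitr.
  by apply: le_trans (ler_normD _ _) (lerD _ _) => //; rewrite distrC.
- by rewrite cy; apply: le_trans (Wl _ Wz x xz) ee.
Qed.

End approximation.

(** * Extension of a pointwise null sequence of functionals *)

(** The limit along a free ultrafilter: it turns a sequence of approximate lifts
    of a functional into a lift. *)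
Lemma generalized_limit (R : realType) : exists Lam : (nat -> R) -> R, [/\
  forall a u v B, (forall n, `|u n| <= B) -> (forall n, `|v n| <= B) ->
    Lam (fun n => a * u n + v n) = a * Lam u + Lam v,
  forall u B, (forall n, `|u n| <= B) -> `|Lam u| <= B &
  forall u l, u @ \oo --> l -> Lam u = l].
Proof.
have [U [UU ooU]] := @ultraFilterLemma nat \oo _.
have UP : ProperFilter U by exact: ultra_proper.
have cvU (u : nat -> R) (B : R) : (forall n, `|u n| <= B) -> cvg (u @ U).
  move=> uB; have cB : compact `[- B, B]%classic by exact: segment_compact.
  have uU : (u @ U) `[- B, B]%classic.
    by apply: (@filterE _ U) => n /=; rewrite in_itv/= -ler_norml uB.
  have [p [_ pc]] := cB (u @ U) _ uU.
  apply/cvg_ex; exists p => V /= Vp.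
  have [//|UV] := in_ultra_setVsetC (u @^-1` V) UU.
  by have [x [Vx]] := pc (~` V) V UV Vp.
exists (fun u => lim (u @ U)); split.
- move=> a u v B uB vB; apply/cvg_lim => //.
  apply: cvgD; last exact: cvU vB.
  by apply: cvgM; [exact: cvg_cst|exact: cvU uB].
- move=> u B uB; have cu := cvU u B uB.
  have : `|u n| @[n --> U] --> `|lim (u @ U)| by apply: cvg_norm.
  by move/cvgr_to_le; apply; exact: filterE.
- move=> u l ul; apply/cvg_lim => //.
  by move=> V /ul; exact: ooU.
Qed.

(** The diagonal argument: each [P k n] holds from some [n] on, and [kap] grows so
    slowly that it stays behind these thresholds. *)
Lemma slow_index (P : nat -> nat -> Prop) :
  (forall n, P 0%N n) -> (forall k, \forall n \near \oo, P k n) ->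
  exists kap : nat -> nat, (forall n, P (kap n) n) /\
    forall k, \forall n \near \oo, (k <= kap n)%N.
Proof.
move=> P0 PP.
pose kap n := \max_(k < n.+1 | `[< P k n >]) (k : nat).
exists kap; split=> [n|k].
  rewrite /kap; case: (eq_bigmax_cond (fun k : 'I_n.+1 => (k : nat))
      (A := [pred k : 'I_n.+1 | `[< P k n >]])).
    by apply/card_gt0P; exists ord0; apply/asboolP.
  by move=> i /asboolP Pi /= ->.
apply: filterS2 (PP k) (nbhs_infty_ge k) => n Pk kn.
rewrite -ltnS in kn; rewrite /kap.
by rewrite (bigD1 (Ordinal kn)) ?leq_maxl//=; exact/asboolP.
Qed.

Section extension.
Variables (R : realType) (K L : topologicalType).
Variables (cK : compact [set: K]) (cL : compact [set: L]).
Variables (phi : K -> L) (cphi : continuous phi) (s : L -> K).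
Hypothesis sK : forall y, phi (s y) = y.
Variables (code : L -> nat) (c : nat -> L -> L) (rho : nat -> K -> K).
Hypothesis code_inj : injective code.
Hypothesis c_loc : forall k y, \forall z \near y, c k z = c k y.
Hypothesis phi_rho : forall k x, phi (rho k x) = c k (phi x).
Hypothesis rho_cvg : forall f : K -> R, continuous f -> forall e, 0 < e ->
  \forall k \near \oo, forall x, `|f x - f (rho k x)| <= e.

Variables (mu : nat -> C R cL -> R) (M : R).
Hypothesis M0 : 0 <= M.
Hypothesis mu_lin : forall n a f g, mu n (a *: f + g) = a * mu n f + mu n g.
Hypothesis mu_bnd : forall n f, `|mu n f| <= M * `|f|.
Hypothesis mu_cvg : forall f, mu ^~ f @ \oo --> (0 : R).

Lemma stepP k (v : L -> R) : (v \o c k) \in sup_pred (cont_space R cL).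
Proof.
apply/mem_set => y U /= /nbhs_singleton Uy.
by apply: filterS (c_loc k y) => z /= ->.
Qed.

Definition step k (v : L -> R) : C R cL := SupFun (stepP k v).

Lemma step_norm k v B : 0 <= B -> (forall y, `|v y| <= B) -> `|step k v| <= B.
Proof. by move=> B0 vB; apply: sup_norm_le => // y; exact: vB. Qed.

(** The bound is uniform in [v]: the steps of [c k] lie in the span of finitely
    many indicators, on each of which [mu n] tends to [0]. *)
Lemma mu_step_small k e : 0 < e -> \forall n \near \oo,
  forall v B, (forall y, `|v y| <= B) -> 0 <= B -> `|mu n (step k v)| <= e * B.
Proof.
move=> e0; have [N cN] := finite_code code cL (c_loc k).
pose ind i := step k (fun y => (code y == i)%:R).
pose d := e / N.+1%:R; have d0 : 0 < d by rewrite divr_gt0.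
have : \forall n \near \oo, forall i : 'I_N, `|mu n (ind i)| <= d.
  apply: filter_forall => i; have /cvgr0Pnorm_le := mu_cvg (ind i).
  exact.
apply: filterS => n small v B vB B0.
have muZ a g : mu n (a *: g) = a * mu n g.
  have m0 : mu n 0 = 0.
    have := mu_lin n (-1) 0 0; rewrite scaler0 addr0 mulN1r addrC subrr.
    exact.
  by have := mu_lin n a g 0; rewrite m0 !addr0.
have [w wP] : exists w : nat -> R, (forall i, `|w i| <= B) /\
    forall y, w (code y) = v y.
  have H i : exists r, `|r| <= B /\ forall y, code y = i -> v y = r.
    have [[y yi]|H] := pselect (exists y, code y = i).
      by exists (v y); split=> // z; rewrite -yi => /code_inj ->.
    by exists 0; rewrite normr0; split=> // y yi; case: H; exists y.
  have [w wP] := choice H; exists w; split=> [i|y]; first by case: (wP i).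
  by case: (wP (code y)) => _ ->.
case: wP => wB wv.
have -> : step k v = \sum_(i < N) w i *: ind i.
  apply: supFun_ext => y.
  have sumE (I : seq 'I_N) : (\sum_(i <- I) w i *: ind i : C R cL) y =
      \sum_(i <- I) w i * ind i y.
    elim: I => [|i I IH]; first by rewrite !big_nil.
    by rewrite !big_cons -IH.
  rewrite sumE (bigD1 (Ordinal (cN y))) //= eqxx mulr1 wv big1 ?addr0// => i.
  by move=> /eqP iy; case: eqP => [E|]; rewrite ?mulr0// ; case: iy; apply: val_inj.
have muS (I : seq 'I_N) : mu n (\sum_(i <- I) w i *: ind i) =
    \sum_(i <- I) w i * mu n (ind i).
  elim: I => [|i I IH]; last by rewrite !big_cons mu_lin IH.
  by rewrite !big_nil -(scale0r 0) muZ mul0r.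
rewrite muS; apply: (@le_trans _ _ (\sum_(i < N) B * d)).
  apply: le_trans (ler_norm_sum _ _ _) (ler_sum _ _) => i _.
  by rewrite normrM ler_pM.
have dN : d * N%:R <= e.
  by rewrite mulrAC ler_pdivrMr ?ltr0n// ler_wpM2l ?ler_nat// ltW.
by rewrite sumr_const card_ord -mulr_natr -mulrA mulrC ler_wpM2r.
Qed.

(** Since [A j h] is continuous for every [h : K -> R], the limit [tmu n] of
    [mu n (A j h)] along [j] is defined on all bounded functions, in
    particular on [f \o rho k].  The index [0] stands for the lift [tmu n] without
    correction, which serves for the first few [n]. *)
Lemma functionals_extension e : 0 < e ->
  exists nu : nat -> C R cK -> R, [/\
    forall n a f g, nu n (a *: f + g) = a * nu n f + nu n g,
    forall n f, `|nu n f| <= (2 + e) * M * `|f|,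
    forall n g, nu n (comp_map cK cphi g) = mu n g &
    forall f, nu ^~ f @ \oo --> (0 : R)].
Proof.
move=> e0; have [Lam [Lam_lin Lam_bnd Lam_lim]] := generalized_limit R.
have muD n f g : mu n f - mu n g = mu n (f - g).
  have -> : f - g = (-1) *: g + f by rewrite scaleN1r addrC.
  by rewrite mu_lin mulN1r addrC.
pose A k (h : K -> R) := step k (h \o s).
have A_bnd n k h B : 0 <= B -> (forall x, `|h x| <= B) -> `|mu n (A k h)| <= M * B.
  move=> B0 hB; apply: le_trans (mu_bnd _ _) _.
  by rewrite ler_wpM2l//; apply: step_norm => // y; exact: hB.
have A_lin k a f g : A k (a *: f + g) = a *: A k f + A k g.
  exact: supFun_ext.
pose tmu n h := Lam (fun j => mu n (A j h)).
have tmu_bnd n h B : 0 <= B -> (forall x, `|h x| <= B) -> `|tmu n h| <= M * B.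
  by move=> B0 hB; apply: Lam_bnd => j; exact: A_bnd.
have tmu_lin n a f g B : 0 <= B -> (forall x, `|f x| <= B) ->
    (forall x, `|g x| <= B) -> tmu n (a *: f + g) = a * tmu n f + tmu n g.
  move=> B0 fB gB; rewrite -(Lam_lin a _ _ (M * B)) /tmu.
  - by congr Lam; apply/funext => j; rewrite A_lin mu_lin.
  - by move=> j; exact: A_bnd.
  - by move=> j; exact: A_bnd.
have tmu_ext n (g : C R cL) : tmu n (g \o phi) = mu n g.
  apply: Lam_lim; apply/cvgrPdist_le => d d0.
  have d1 : 0 < d / (M + 1) by rewrite divr_gt0// ltr_wpDl.
  have cg : continuous (g \o phi).
    by move=> x; apply: continuous_comp; [exact: cphi|exact: (supFunS g)].
  apply: filterS (rho_cvg cg d1) => j jP.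
  rewrite muD; apply: le_trans (mu_bnd _ _) _.
  apply: (@le_trans _ _ (M * (d / (M + 1)))).
    rewrite ler_wpM2l//; apply: sup_norm_le; first exact: ltW.
    move=> y; have := jP (s y); rewrite /= phi_rho sK.
    by rewrite -(sK (c j y)).
  rewrite mulrA ler_pdivrMr ?ltr_wpDl//; nra.
pose corr k n f := if k is k'.+1 then mu n (A k' f) - tmu n (f \o rho k') else 0.
pose P k n := if k is k'.+1 then forall (f : C R cK),
  `|mu n (A k' f)| <= e * M * `|f| /\ `|mu n (A k' f)| <= k%:R^-1 * `|f| else True.
have [||kap [kapP kap_oo]] := @slow_index P; first by [].
  case=> [|k]; first exact: filterE.
  have k0 : 0 < k.+1%:R^-1 :> R by rewrite invr_gt0.
  have H1 := mu_step_small k k0.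
  (* For [M = 0] the bound [e * M] is no positive threshold, but [mu n] is 0. *)
  have [M_0|Mn0] := eqVneq M 0.
    apply: filterS H1 => n nP f; split.
      by apply: le_trans (mu_bnd _ _) _; rewrite M_0 mulr0 !mul0r.
    apply: nP (normr_ge0 f) => y; exact: sup_norm_ub.
  have eM : 0 < e * M by rewrite mulr_gt0// lt_neqAle eq_sym Mn0.
  apply: filterS2 H1 (mu_step_small k eM) => n n1 n2 f; split.
    apply: n2 (normr_ge0 f) => y; exact: sup_norm_ub.
  apply: n1 (normr_ge0 f) => y; exact: sup_norm_ub.
pose nu n (f : C R cK) := tmu n f + corr (kap n) n f.
have nuE n k' (f : C R cK) B : kap n = k'.+1 -> (forall x, `|f x - f (rho k' x)| <= B) ->
    0 <= B -> `|nu n f| <= M * B + `|mu n (A k' f)|.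
  move=> kE fB B0; rewrite /nu kE /= addrCA addrC.
  apply: le_trans (ler_normD _ _) _; rewrite lerD2r.
  have -> : tmu n f - tmu n (f \o rho k') = tmu n ((-1) *: (f \o rho k') + f).
    rewrite (@tmu_lin _ _ _ _ `|f|) ?mulN1r 1?addrC// => x; exact: sup_norm_ub.
  by apply: tmu_bnd => // x; rewrite /= scaleN1r addrC; exact: fB.
exists nu; split.
- move=> n a f g.
  have fx x : `|f x| <= `|f| + `|g|.
    by apply: le_trans (sup_norm_ub f x) _; rewrite lerDl.
  have gx x : `|g x| <= `|f| + `|g|.
    by apply: le_trans (sup_norm_ub g x) _; rewrite lerDr.
  have B0 : 0 <= `|f| + `|g| by rewrite addr_ge0.
  rewrite /nu (_ : (a *: f + g : C R cK) = a *: (f : K -> R) + (g : K -> R) :> (K -> R))//.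
  rewrite (tmu_lin _ _ _ _ _ B0 fx gx).
  case: (kap n) => [|k] /=; first by rewrite !addr0.
  rewrite A_lin mu_lin.
  rewrite (_ : _ \o rho k = a *: (f \o rho k) + (g \o rho k))//.
  rewrite (tmu_lin n a _ _ _ B0 (fun x => fx (rho k x)) (fun x => gx (rho k x))).
  lra.
- move=> n f; case E : (kap n) => [|k].
    rewrite /nu E /= addr0; apply: le_trans (tmu_bnd _ _ _ (normr_ge0 f) _) _.
      by move=> x; exact: sup_norm_ub.
    rewrite ler_wpM2r// ler_peMl//; lra.
  have := kapP n; rewrite E => /(_ f)[H _].
  have fx x : `|f x - f (rho k x)| <= 2 * `|f|.
    apply: le_trans (ler_normB _ _) _; rewrite mulr_natl mulr2n lerD//.
      exact: (sup_norm_ub f).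
    exact: (sup_norm_ub f).
  apply: le_trans (nuE n k f _ E fx _) _; first by rewrite mulr_ge0.
  lra.
- move=> n g; rewrite /nu tmu_ext; case: (kap n) => [|k] /=; first by rewrite addr0.
  have -> : g \o phi \o rho k = A k (g \o phi) \o phi.
    by apply/funext => x /=; rewrite phi_rho sK.
  by rewrite tmu_ext subrr addr0.
- move=> f; apply/cvgr0Pnorm_le => d d0.
  have d2 : 0 < d / 2 / (M + 1) by rewrite !divr_gt0// ltr_wpDl.
  have cf : continuous f by exact: (supFunS f).
  have [k0 _ k0P] := rho_cvg cf d2.
  have [k1 k1P] : exists k1 : nat, forall k : nat, (k1 <= k)%N -> k.+1%:R^-1 * `|f| <= d / 2.
    exists (Num.truncn (`|f| * (d / 2)^-1)).+1 => k kk.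
    rewrite ler_pdivrMl// -ler_pdivrMr ?divr_gt0//.
    apply/ltW/(lt_le_trans (truncnS_gt _)).
    by rewrite ler_nat; exact: leqW.
  apply: filterS (kap_oo (maxn k0 k1).+1) => n; case E : (kap n) => [//|k].
  rewrite ltnS geq_max => /andP[kk0 kk1].
  have := kapP n; rewrite E => /(_ f)[_ H].
  apply: le_trans (nuE n k f _ E (k0P k kk0) _) _; first exact: ltW.
  rewrite [leRHS]splitr lerD// ?(le_trans H (k1P k kk1))//.
  rewrite mulrA ler_pdivrMr ?ltr_wpDl//; nra.
Qed.

End extension.

(** * Operator norms and the main theorem *)

Section operator_norm.
Variables (R : realType) (V W : normedModType R) (T : {linear V -> W}).

Lemma opnorm_ub : bounded_operator T -> forall x, `|T x| <= opnorm T * `|x|.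
Proof.
move=> /linear_boundedP/pinfty_ex_gt0[r r0 rT] x.
have ub y : `|y| <= 1 -> `|T y| <= opnorm T.
  move=> y1; apply: ub_le_sup; last by exists y.
  exists r => _ [z z1 <-]; apply: le_trans (rT z) _.
  by rewrite -[leRHS]mulr1 ler_wpM2l// ltW.
have [->|x0] := eqVneq x 0; first by rewrite linear0 !normr0 mulr0.
have nx : 0 < `|x| by rewrite normr_gt0.
have := ub (`|x|^-1 *: x).
rewrite normrZ normfV normr_id mulVf ?gt_eqF// => /(_ (lexx _)).
by rewrite linearZ normrZ normfV normr_id ler_pdivrMl// mulrC.
Qed.

Lemma opnorm_ge0 : bounded_operator T -> 0 <= opnorm T.
Proof.
move=> /linear_boundedP/pinfty_ex_gt0[r r0 rT].
rewrite -(normr0 W) -(linear0 T); apply: ub_le_sup; last first.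
  by exists 0 => //=; rewrite normr0.
exists r => _ [z z1 <-]; apply: le_trans (rT z) _.
by rewrite -[leRHS]mulr1 ler_wpM2l// ltW.
Qed.

Lemma opnorm_le B : 0 <= B -> (forall x, `|T x| <= B * `|x|) ->
  bounded_operator T /\ opnorm T <= B.
Proof.
move=> B0 TB; split.
  apply/linear_boundedP; near=> r => x; apply: le_trans (TB x) _.
  rewrite ler_wpM2r//; near: r; exact: nbhs_pinfty_ge.
apply: ge_sup; first by exists `|T 0|; exists 0 => //=; rewrite normr0.
move=> _ [x /= x1 <-]; apply: le_trans (TB x) _.
by rewrite -[leRHS]mulr1 ler_wpM2l.
Unshelve. all: by end_near. Qed.

End operator_norm.

Unset Implicit Arguments.

Theorem theorem3p1 (R : realType)
    (d : Order.disp_t) (K : orderTopologicalType d) (cK : compact [set: K])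
    (L : topologicalType) (cL : compact [set: L]) (hL : hausdorff_space L)
    (countL : countable [set: L])
    (phi : K -> L) (cphi : continuous phi)
    (sphi : set_surj [set: K] [set: L] phi)
    (e : R) (e_gt0 : 0 < e) :
  c0_extension_property (comp_range R cK cL cphi sphi) (2 + e).
Proof.
move=> T bT.
have [code code_inj'] := countable_injP _ countL.
have code_inj : injective code by move=> x y; apply: code_inj'; rewrite inE.
have zL : zero_dimensional L := countable_zero_dimensional R cL hL countL.
have surj y : exists x, phi x = y by have [x _ <-] := sphi y I; exists x.
have [s sK] := choice surj.
have [c [rho [c_loc phi_rho rho_cvg]]] :=
  collapsing_maps cK cL zL code_inj cphi surj R.
have gP (g : C R cL) :
    comp_map cK cphi g \in subspace_pred (comp_range R cK cL cphi sphi).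
  by apply/mem_set; exists g.
pose incl g := SubspaceOf (gP g).
pose mu n (g : C R cL) : R := T (incl g) n.
have mu_lin n a f g : mu n (a *: f + g) = a * mu n f + mu n g.
  rewrite /mu (_ : incl (a *: f + g) = a *: incl f + incl g) ?linearP//.
  exact/val_inj/comp_map_lin.
have M0 : 0 <= opnorm T by exact: opnorm_ge0 bT.
have mu_bnd n g : `|mu n g| <= opnorm T * `|g|.
  apply: le_trans (sup_norm_ub (T (incl g)) n) _.
  apply: le_trans (opnorm_ub bT (incl g)) _.
  rewrite ler_wpM2l//.
  by rewrite -[leRHS](comp_map_norm cK cphi sphi g).
have mu_cvg g : mu ^~ g @ \oo --> (0 : R) := supFunS (T (incl g)).
have [nu [nu_lin nu_bnd nu_ext nu_cvg]] := functionals_extension cK cphi sK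
  code_inj c_loc phi_rho rho_cvg M0 mu_lin mu_bnd mu_cvg e_gt0.
have nuP f : (nu ^~ f) \in sup_pred (null_space R) by exact/mem_set/nu_cvg.
pose T0 (f : C R cK) : c0 R := SupFun (nuP f).
have T0lin : linear T0.
  by move=> a f g; apply: supFun_ext => n; exact: nu_lin.
pose T' : {linear C R cK -> c0 R} :=
  HB.pack T0 (GRing.isLinear.Build _ _ _ _ T0 T0lin).
have B0 : 0 <= (2 + e) * opnorm T by rewrite mulr_ge0// addr_ge0// ltW.
have T'B f : `|T' f| <= (2 + e) * opnorm T * `|f|.
  apply: sup_norm_le => [|n]; first by rewrite mulr_ge0.
  exact: nu_bnd.
have [bT' nT'] := opnorm_le B0 T'B.
exists T'; split=> // y; case: y => u uP.
have [g _ gu] := set_mem uP.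
apply: supFun_ext => n; rewrite -[RHS]/(T (SubspaceOf uP) n).
have -> : SubspaceOf uP = incl g by apply/val_inj; rewrite /= gu.
exact: nu_ext.
Qed.
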